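(* Let $M$ be a rank $d$ positroid on $[n]$ with matroid polytope $\Gamma_M$, and let $\Pi_M$ be the partition of $[n]$ into the ground sets of the connected components of $M$ (a non-crossing partition). For $\mathbf{x}\in\mathbb{R}^n$ set $y_i = x_1+\dots+x_i$ for $1\leq i\leq n$, and for $i,j\in[n]$ write $i\sim^* j$ if $y_j - y_i$ is constant on $\Gamma_M$. Let $\Pi^*_M$ be the partition of $[n]$ into the equivalence classes of $\sim^*$. Then $\Pi^*_M$ is the Kreweras complement $K(\Pi_M)$ of $\Pi_M$; in particular, $\Pi^*_M$ is non-crossing.
   Context: A matroid $M$ on $[n]$ is a positroid if there is a real $d\times n$ matrix of rank $d$ with all maximal minors nonnegative whose column matroid is $M$ (column $i$ corresponding to element $i$). A matroid is connected if it is not a direct sum of two matroids on nonempty ground sets; the connected components of a matroid partition its ground set. The matroid polytope is $\Gamma_M=\mathrm{conv}\{e_B : B \text{ a basis of } M\}\subset\mathbb{R}^n$ with $e_B=\sum_{i\in B}e_i$. A partition of $[n]$ into nonempty blocks is non-crossing if there are no $a,b,c,d$ in cyclic order with $a,c$ in one block and $b,d$ in a different block. Kreweras complement: for a non-crossing partition $\Pi$ of $[n]$, place nodes $1,1',2,2',\dots,n,n'$ in this order around a circle and draw $\Pi$ on $1,\dots,n$; $K(\Pi)$ is the coarsest partition of $[n]$ such that, regarded as a partition $K(\Pi)'$ of $\{1',\dots,n'\}$, the partition $\Pi\cup K(\Pi)'$ of $\{1,1',\dots,n,n'\}$ is non-crossing. *)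

(* Defs.v *)
From HB Require Import structures.
From mathcomp Require Import all_boot all_order all_algebra.
From mathcomp Require Import boolp reals.

Set Implicit Arguments.
Unset Strict Implicit.
Unset Printing Implicit Defensive.

Import Order.TTheory GRing.Theory Num.Theory.
Local Open Scope ring_scope.

Record matroid (T : finType) (E : {set T}) := Matroid {
  bases : {set {set T}};
  bases_subset : forall B, B \in bases -> B \subset E;
  bases_nonempty : bases != set0;
  bases_exchange : forall A B, A \in bases -> B \in bases ->
    forall a, a \in A :\: B ->
    exists2 b, b \in B :\: A & b |: (A :\ a) \in bases
}.

Definition rank_of (T : finType) (E : {set T}) (M : matroid E) : nat :=
  \max_(B in bases M) #|B|.

Definition is_direct_sum (T : finType) (E E1 E2 : {set T})
    (M : matroid E) (M1 : matroid E1) (M2 : matroid E2) : Prop :=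
  [/\ [disjoint E1 & E2], E = E1 :|: E2
    & bases M = [set B1 :|: B2 | B1 in bases M1, B2 in bases M2]].

Definition connected (T : finType) (E : {set T}) (M : matroid E) : Prop :=
  ~ exists (E1 E2 : {set T}) (M1 : matroid E1) (M2 : matroid E2),
      [/\ E1 != set0, E2 != set0 & is_direct_sum M M1 M2].

(* Connected components are the connected direct summands on nonempty ground
   sets; the complementary summand M2 may have empty ground set, which is the
   case where M itself is connected. *)
Definition is_connected_component (T : finType) (E S : {set T})
    (M : matroid E) (N : matroid S) : Prop :=
  [/\ S != set0, connected N
    & exists (E2 : {set T}) (M2 : matroid E2), is_direct_sum M N M2].

Definition components (T : finType) (E : {set T}) (M : matroid E) :
    {set {set T}} :=
  [set S : {set T} | `[< exists N : matroid S, is_connected_component M N >]].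

Section Positroid.
Variables (R : realType) (n : nat).

Definition columns_independent (d : nat) (A : 'M[R]_(d, n)) (S : {set 'I_n}) :
    bool :=
  row_free (colsub (fun k : 'I_#|S| => enum_val k) A)^T.

Definition column_bases (d : nat) (A : 'M[R]_(d, n)) : {set {set 'I_n}} :=
  [set B | maxset (columns_independent A) B].

Definition maximal_minors_nonneg (d : nat) (A : 'M[R]_(d, n)) : Prop :=
  forall f : 'I_d -> 'I_n, {homo f : i j / (i < j)%N} ->
    0 <= \det (colsub f A).

Definition positroid (M : matroid [set: 'I_n]) : Prop :=
  exists (d : nat) (A : 'M[R]_(d, n)),
    [/\ \rank A = d, maximal_minors_nonneg A & bases M = column_bases A].

Definition indicator (B : {set 'I_n}) : 'rV[R]_n := \row_i (i \in B)%:R.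

Definition matroid_polytope (M : matroid [set: 'I_n]) (x : 'rV[R]_n) : Prop :=
  exists w : {set 'I_n} -> R,
    [/\ forall B, 0 <= w B, \sum_(B in bases M) w B = 1
      & x = \sum_(B in bases M) w B *: indicator B].

Definition prefix_sum (x : 'rV[R]_n) (i : 'I_n) : R :=
  \sum_(k < n | (k <= i)%N) x 0 k.

Definition dual_equiv (M : matroid [set: 'I_n]) (i j : 'I_n) : Prop :=
  exists c : R, forall x : 'rV[R]_n, matroid_polytope M x ->
    prefix_sum x j - prefix_sum x i = c.

Definition dual_partition (M : matroid [set: 'I_n]) : {set {set 'I_n}} :=
  equivalence_partition (fun i j => `[< dual_equiv M i j >]) [set: 'I_n].

End Positroid.

Section NonCrossing.
Variables (disp : Order.disp_t) (T : finOrderType disp).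

Definition cyclic_order (a b c d : T) : bool :=
  [|| sorted <%O [:: a; b; c; d], sorted <%O [:: b; c; d; a],
      sorted <%O [:: c; d; a; b] | sorted <%O [:: d; a; b; c]].

Definition noncrossing (P : {set {set T}}) : Prop :=
  forall A B : {set T}, A \in P -> B \in P -> A != B ->
  forall a b c d : T, a \in A -> c \in A -> b \in B -> d \in B ->
    ~~ cyclic_order a b c d.

Definition noncrossing_partition (P : {set {set T}}) : Prop :=
  partition P [set: T] /\ noncrossing P.

End NonCrossing.

(* In the lexicographic order on 'I_n *l bool, (i, false) stands for the node i
   and (i, true) for the node i', giving 1 < 1' < 2 < 2' < ... < n < n'. *)
Definition node (n : nat) (primed : bool) (i : 'I_n) : 'I_n *l bool :=
  (i, primed).

Definition interleave (n : nat) (P K : {set {set 'I_n}}) :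
    {set {set 'I_n *l bool}} :=
  [set [set node false i | i in B] | B : {set 'I_n} in P] :|:
  [set [set node true i | i in B] | B : {set 'I_n} in K].

Definition coarser (T : finType) (K Q : {set {set T}}) : Prop :=
  forall B, B \in Q -> exists2 C, C \in K & B \subset C.

Definition is_kreweras_complement (n : nat) (P K : {set {set 'I_n}}) : Prop :=
  [/\ partition K [set: 'I_n], noncrossing_partition (interleave P K)
    & forall Q : {set {set 'I_n}}, partition Q [set: 'I_n] ->
        noncrossing_partition (interleave P Q) -> coarser K Q].

(* Main.v *)
(** Call [S] a separator if every basis meets [S] in the same number of
    elements. Exchanging bases shows that separators form a Boolean algebra whose
    atoms are the connected components, and that [i ~* j] with [i <= j] means that
    the interval (i, j] is a separator, i.e. a union of components. This yields the
    Kreweras description of [~*] directly.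

    If two components of a positroid crossed, exchange pairs inside them could be
    chosen to cross, giving p < q < r < s and a set I such that pqI, rsI, psI, qrI
    are bases but prI is not. The three-term Pluecker relation
    D(pr) D(qs) = D(pq) D(rs) + D(ps) D(qr) would then equate 0 with a sum of two
    positive terms. *)
From mathcomp Require Import all_boot all_order all_fingroup all_algebra.
From mathcomp Require Import boolp reals.
From mathcomp Require Import zify ring.
Require Import Defs.

Set Implicit Arguments.
Unset Strict Implicit.
Unset Printing Implicit Defensive.

Import Order.TTheory GRing.Theory Num.Theory.
Local Open Scope ring_scope.

(** * Separators and direct sums *)

Section Separators.
Variables (T : finType) (E : {set T}) (M : matroid E).
Implicit Types (A B S X : {set T}).

Definition separator S : bool :=
  [forall A in bases M, forall B in bases M, #|A :&: S| == #|B :&: S|].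

Lemma separatorP S :
  reflect {in bases M &, forall A B, #|A :&: S| = #|B :&: S|} (separator S).
Proof.
apply: (iffP forall_inP) => [h A B hA hB|h A hA].
  by have /forall_inP /(_ B hB) /eqP := h A hA.
by apply/forall_inP => B hB; apply/eqP; apply: h.
Qed.

(** Induction along a walk of exchanges: each step towards [B] removes an element of [A :\: B], so
    this difference shrinks until [A] has become [B]. *)
Lemma base_walk (P : {set T} -> Prop) B : B \in bases M ->
    (forall A a b, A \in bases M -> P A -> a \in A :\: B -> b \in B :\: A ->
       b |: (A :\ a) \in bases M -> P (b |: (A :\ a))) ->
  forall A, A \in bases M -> P A -> P B.
Proof.
move=> hB step A; have [m] := ubnP #|A :\: B|.
elim: m A => // m IH A hm hA PA.
have [A0|[a ha]] := set_0Vmem (A :\: B).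
  (* Here [A] lies inside [B]. An element of [B :\: A] could only be exchanged for one of the empty
     [A :\: B], so there is none. *)
  suff <- : A = B by [].
  apply/eqP; rewrite eqEsubset -setD_eq0 A0 eqxx /= -setD_eq0.
  apply/set0Pn => -[b hb].
  have [a] := bases_exchange hB hA hb.
  by rewrite A0 inE.
have [b hb hAB] := bases_exchange hA hB ha.
apply: (IH (b |: (A :\ a))) => //; last exact: step PA _ _ _.
rewrite -ltnS; apply: leq_trans hm; rewrite ltnS.
apply: proper_card; apply/properP; split.
  apply/subsetP => x; rewrite !inE => /andP[xB /orP[/eqP xb|/andP[_ ->]]].
    by move: hb xB; rewrite xb !inE => /andP[_ ->].
  by rewrite xB.
exists a => //; rewrite !inE eqxx orbF negb_and negbK.
by apply/orP; right; apply: contraTneq ha => ->; move: hb; rewrite !inE => /andP[_ ->].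
Qed.

Lemma bases_card : {in bases M &, forall A B, #|A| = #|B|}.
Proof.
move=> A B hA hB.
apply: (base_walk (P := fun C => #|A| = #|C|) hB _ hA erefl).
move=> C a b hC -> /setDP[aC _] /setDP[_ bC] _.
by rewrite cardsU1 (cardsD1 a C) aC !inE negb_and bC orbT.
Qed.

(** Kept additive to avoid truncated subtraction. *)
Lemma card_exchangeI S A a b : a \in A -> b \notin A ->
  (#|(b |: (A :\ a)) :&: S| + (a \in S) = #|A :&: S| + (b \in S))%N.
Proof.
move=> aA bA; have ab : b != a by apply: contraNneq bA => ->.
rewrite (cardsD1 b (_ :&: S)) (cardsD1 a (A :&: S)) !inE aA eqxx /=.
have -> : ((b |: (A :\ a)) :&: S) :\ b = (A :&: S) :\ a.
  apply/setP => x; rewrite !inE; have [->|xb] := eqVneq x b.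
    by rewrite (negbTE bA) andbF.
  by rewrite /= andbA.
lia.
Qed.

(* The exchanges that move [B] towards [A] off [S] never touch [S], as the
   trace on [S] has constant size. *)
Lemma separator_glue S A B : separator S -> A \in bases M -> B \in bases M ->
  (A :&: S) :|: (B :\: S) \in bases M.
Proof.
move=> /separatorP sS; have [m] := ubnP #|(A :\: S) :\: B|.
elim: m A => // m IH A hm hA hB.
have [A0|[a]] := set_0Vmem ((A :\: S) :\: B).
  suff <- : A :\: S = B :\: S by rewrite setID.
  apply/eqP; rewrite eqEcard; apply/andP; split.
    apply/subsetP => x xA; have : x \notin (A :\: S) :\: B by rewrite A0 inE.
    by move: xA; rewrite !inE => /andP[-> ->]; rewrite !andbT negbK.
  have := bases_card hA hB; rewrite -(cardsID S A) -(cardsID S B) (sS _ _ hA hB).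
  by move=> /addnI ->.
rewrite !inE => /and3P[aB aS aA].
have [|b] := bases_exchange hA hB (a := a); first by rewrite !inE aB.
rewrite !inE => /andP[bA bB] hAB.
have bS : b \notin S.
  have := card_exchangeI S aA bA; rewrite (sS _ _ hAB hA) (negbTE aS) addn0.
  by case: (b \in S) => //=; lia.
have -> : A :&: S = (b |: (A :\ a)) :&: S.
  apply/setP => x; rewrite !inE; have [->|_] := eqVneq x b.
    by rewrite (negbTE bA) (negbTE bS).
  by have [->|//] := eqVneq x a; rewrite (negbTE aS) andbF.
apply: IH => //; rewrite -ltnS; apply: leq_trans hm; rewrite ltnS.
apply: proper_card; apply/properP; split.
  apply/subsetP => x; rewrite !inE; have [->|_] := eqVneq x b; first by rewrite bB.
  by move=> /and3P[-> -> /andP[_ ->]].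
exists a; rewrite !inE ?aB ?aS //= eqxx orbF.
by apply: contraNneq aB => ->.
Qed.

Lemma separatorT : separator [set: T].
Proof. by apply/separatorP => A B hA hB; rewrite !setIT; apply: bases_card. Qed.

Lemma separator_ground : separator E.
Proof.
apply/separatorP => A B hA hB.
rewrite (setIidPl (bases_subset hA)) (setIidPl (bases_subset hB)).
exact: bases_card.
Qed.

Lemma separatorD S S' : S' \subset S -> separator S -> separator S' ->
  separator (S :\: S').
Proof.
move=> sub /separatorP sS /separatorP sS'; apply/separatorP => A B hA hB.
have split C : #|C :&: S| = (#|C :&: S'| + #|C :&: (S :\: S')|)%N.
  rewrite -(cardsID S' (C :&: S)) -setIA (setIidPr sub).
  by congr (_ + #|pred_of_set _|)%N; rewrite setIDA.
by have := sS _ _ hA hB; rewrite !split (sS' _ _ hA hB) => /addnI.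
Qed.

Lemma separatorC S : separator S -> separator (~: S).
Proof. by rewrite -setTD; apply: separatorD; rewrite ?subsetT ?separatorT. Qed.

(** Gluing the trace of [A] on [S] to [B] off [S] gives a basis that differs from [B] only inside
    [S]. Comparing the two on [S'] cancels the common part off [S] and leaves the traces on
    [S :&: S']. *)
Lemma separatorI S S' : separator S -> separator S' -> separator (S :&: S').
Proof.
move=> sS /separatorP sS'; apply/separatorP => A B hA hB.
have hG := separator_glue sS hA hB.
have split C : #|((C :&: S) :|: (B :\: S)) :&: S'|
    = (#|C :&: (S :&: S')| + #|(B :\: S) :&: S'|)%N.
  rewrite setIUl cardsU -setIA [X in (_ - X)%N](_ : _ = 0%N) ?subn0 //.
  apply/eqP; rewrite cards_eq0; apply/eqP/setP => x; rewrite !inE.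
  by case: (x \in S); rewrite ?andbF.
have := sS' _ _ hG hB; rewrite split -[X in _ = #|pred_of_set (X :&: _)|](setID B S) split.
exact: addIn.
Qed.

Lemma separator_bigcap (I : finType) (P : pred I) (F : I -> {set T}) :
  (forall i, P i -> separator (F i)) -> separator (\bigcap_(i | P i) F i).
Proof.
by move=> sF; apply: (big_ind (fun S => separator S)) => //; [exact: separatorT|exact: separatorI].
Qed.

(** Equivalently, [a] and [b] are distinct elements of a common circuit; the form with bases can be
    compared directly with separators. *)
Definition exchangeable a b : Prop :=
  exists B, [/\ B \in bases M, a \in B, b \notin B & b |: (B :\ a) \in bases M].

Lemma exchangeable_sym a b : exchangeable a b -> exchangeable b a.
Proof.
move=> [B [hB aB bB hB']]; exists (b |: (B :\ a)).
have ab : a != b by apply: contraNneq bB => <-.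
split; rewrite ?in_setU1 ?in_setD1 ?eqxx ?(negbTE ab) //.
suff -> : a |: ((b |: (B :\ a)) :\ b) = B by [].
apply/setP => x; rewrite !inE; have [->|_] := eqVneq x a; first by rewrite aB.
by have [->|] := eqVneq x b; rewrite ?(negbTE bB).
Qed.

Lemma separator_exchangeable S a b :
  separator S -> exchangeable a b -> (a \in S) = (b \in S).
Proof.
move=> /separatorP sS [B [hB aB bB hB']].
have := card_exchangeI S aB bB; rewrite (sS _ _ hB' hB).
by case: (a \in S); case: (b \in S) => //=; lia.
Qed.

(** Any two bases are joined by exchanges, none of which changes the size of the trace on [S].
    Together with [separator_exchangeable], separators are the sets that no exchangeable pair
    straddles. *)
Lemma exchangeable_separator S :
  (forall a b, exchangeable a b -> (a \in S) = (b \in S)) -> separator S.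
Proof.
move=> hS; apply/separatorP => A B hA hB.
apply: (base_walk (P := fun C => #|A :&: S| = #|C :&: S|) hB _ hA erefl).
move=> C a b hC -> /setDP[aC _] /setDP[_ bC] hC'.
have := card_exchangeI S aC bC; rewrite (hS a b); last by exists C.
by move/addIn.
Qed.

Lemma restriction_exists S : S \subset E -> separator S ->
  exists N : matroid S, bases N = [set B :&: S | B in bases M].
Proof.
move=> SE sS; pose bs := [set B :&: S | B in bases M].
have h1 B : B \in bs -> B \subset S by move=> /imsetP[C _ ->]; apply: subsetIr.
have h2 : bs != set0.
  by have /set0Pn[B hB] := bases_nonempty M; apply/set0Pn; exists (B :&: S); apply: imset_f.
have h3 A B : A \in bs -> B \in bs -> forall a, a \in A :\: B ->
    exists2 b, b \in B :\: A & b |: (A :\ a) \in bs.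
  move=> /imsetP[{}A hA ->] /imsetP[{}B hB ->] a.
  rewrite !inE => /andP[aB /andP[aA aS]].
  move: aB; rewrite aS andbT => aB.
  (* Giving [B] the part of [A] off [S] confines the difference of the two bases to [S], so the
     exchange in [M] stays inside [S]. *)
  have hG := separator_glue sS hB hA.
  have [|b] := bases_exchange hA hG (a := a).
    by rewrite !inE (negbTE aB) aA aS.
  rewrite !inE => /andP[bA]; rewrite (negbTE bA) andbF orbF => /andP[bB bS] h.
  exists b; first by rewrite !inE (negbTE bA) bB bS.
  apply/imsetP; exists (b |: (A :\ a)) => //; apply/setP => x; rewrite !inE.
  have [->|_] := eqVneq x b; first by rewrite bS.
  by rewrite andbA.
by exists (Matroid h1 h2 h3).
Qed.

(** By gluing, any trace on [S] and any trace off [S] unite to a basis, which is what the sum of the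
    two restrictions requires. *)
Lemma separator_direct_sum S : S \subset E -> separator S ->
  exists (M1 : matroid S) (M2 : matroid (E :\: S)), is_direct_sum M M1 M2.
Proof.
move=> SE sS.
have [M1 eM1] := restriction_exists SE sS.
have [M2 eM2] := restriction_exists (subsetDl E S) (separatorD SE separator_ground sS).
exists M1, M2; split.
- by rewrite -setI_eq0; apply/eqP/setP => x; rewrite !inE; case: (x \in S).
- by rewrite -{1}(setID E S) (setIidPr SE).
have dE C : C \in bases M -> C :&: (E :\: S) = C :\: S.
  by move=> /bases_subset /setIidPl {2}<-; rewrite setIDA.
apply/setP => B; apply/idP/imset2P.
  move=> hB; exists (B :&: S) (B :&: (E :\: S)).
  - by rewrite eM1; apply/imsetP; exists B.
  - by rewrite eM2; apply/imsetP; exists B.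
  - by rewrite dE // setID.
rewrite eM1 eM2 => -[_ _ /imsetP[A hA ->] /imsetP[C hC ->] ->].
by rewrite dE //; apply: separator_glue.
Qed.
End Separators.

(** This moves separators between a matroid and its summand: bases of [M2] miss [S], so a basis of
    [M] and its part in [M1] have the same trace on [S]. *)
Lemma direct_sum_separator (T : finType) (E E1 E2 S : {set T}) (M : matroid E)
    (M1 : matroid E1) (M2 : matroid E2) :
  is_direct_sum M M1 M2 -> S \subset E1 -> separator M S = separator M1 S.
Proof.
move=> [dis _ eM] sub.
have tr B1 B2 : B2 \in bases M2 -> (B1 :|: B2) :&: S = B1 :&: S.
  move=> /bases_subset hB2; rewrite setIUl (_ : B2 :&: S = set0) ?setU0 //.
  apply/eqP; rewrite setI_eq0 disjoint_sym.
  exact: disjointWl sub (disjointWr hB2 dis).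
apply/separatorP/separatorP => sS A B.
  move=> hA hB; have /set0Pn[C hC] := bases_nonempty M2.
  rewrite -(tr A C hC) -(tr B C hC).
  by apply: sS; rewrite eM; apply: imset2_f.
rewrite eM => /imset2P[A1 A2 hA1 hA2 ->] /imset2P[B1 B2 hB1 hB2 ->].
by rewrite !tr //; apply: sS.
Qed.

(** * Connected components *)

Section Components.
Variables (T : finType) (M : matroid [set: T]).
Implicit Types (i j : T) (S : {set T}).

Definition same_separators i j : bool :=
  [forall S, separator M S ==> ((i \in S) == (j \in S))].

Lemma same_separatorsP i j :
  reflect (forall S, separator M S -> (i \in S) = (j \in S))
          (same_separators i j).
Proof.
apply: (iffP forall_inP) => h S sS; first exact/eqP/h.
by apply/eqP/h.
Qed.

Lemma same_separators_sym i j : same_separators i j = same_separators j i.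
Proof. by apply/same_separatorsP/same_separatorsP => h S sS; rewrite h. Qed.

Lemma same_separators_trans i j :
  same_separators i j -> same_separators i =1 same_separators j.
Proof.
move=> /same_separatorsP ij k.
by apply/same_separatorsP/same_separatorsP => h S sS; rewrite -h // ij.
Qed.

Lemma same_separators_equiv :
  {in [set: T] & &, equivalence_rel same_separators}.
Proof.
move=> x y z _ _ _; split; first exact/same_separatorsP.
by move=> /same_separators_trans.
Qed.

Definition component_of i : {set T} := [set j | same_separators i j].

Lemma mem_component_of i : i \in component_of i.
Proof. by rewrite inE; apply/same_separatorsP. Qed.

(** The class is the intersection of all separators through [i]; a separator missing [i] imposes the
    same constraint through its complement. *)
Lemma component_of_separator i : separator M (component_of i).
Proof.
suff -> : component_of i = \bigcap_(S | separator M S && (i \in S)) S.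
  by apply: separator_bigcap => S /andP[].
apply/setP => j; rewrite inE; apply/same_separatorsP/bigcapP => [h S /andP[sS iS]|h S sS].
  by rewrite -h.
case iS : (i \in S); first by rewrite h // sS.
have := h (~: S); rewrite separatorC // !inE iS => /(_ isT).
by case: (j \in S).
Qed.

(** A component is a separator, so it contains the class of each of its points, and a strictly
    smaller class would split the connected summand. Conversely, splitting the restriction to a
    class would give a separator of [M] that cuts this class. *)
Lemma component_ofP S :
  reflect (exists i, S = component_of i) (S \in components M).
Proof.
apply: (iffP idP).
  rewrite inE => /asboolP[N [S0 cN [E2 [M2 hM2]]]].
  have /set0Pn[i iS] := S0; exists i.
  have sS : separator M S by rewrite (direct_sum_separator hM2) ?separator_ground.
  have sub : component_of i \subset S.
    by apply/subsetP => j; rewrite inE => /same_separatorsP /(_ S sS) <-.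
  apply/eqP; rewrite eqEsubset sub andbT -setD_eq0; apply/negP => /negP D0.
  have sN : separator N (component_of i).
    by rewrite -(direct_sum_separator hM2) // component_of_separator.
  have [N1 [N2 hN]] := separator_direct_sum sub sN.
  apply: cN; exists (component_of i), (S :\: component_of i), N1, N2; split=> //.
  by apply/set0Pn; exists i; apply: mem_component_of.
move=> [i ->]; rewrite inE; apply/asboolP.
have [N [M2 hM2]] := separator_direct_sum (subsetT _) (component_of_separator i).
exists N; split; first by apply/set0Pn; exists i; apply: mem_component_of.
  move=> [E1 [E2 [N1 [N2 [/set0Pn[x xE1] /set0Pn[y yE2] hN]]]]].
  have [dis eS _] := hN.
  have sE1 : separator M E1.
    rewrite (direct_sum_separator hM2) ?eS ?subsetUl //.
    by rewrite (direct_sum_separator hN) ?separator_ground.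
  have xi : x \in component_of i by rewrite eS inE xE1.
  have yi : y \in component_of i by rewrite eS inE yE2 orbT.
  move: xi yi; rewrite !inE => /same_separatorsP /(_ E1 sE1) ix /same_separatorsP /(_ E1 sE1).
  rewrite ix xE1; move/esym => yE1; move: dis.
  by rewrite -setI_eq0 => /eqP/setP/(_ y); rewrite !inE yE1 yE2.
by exists (~: component_of i); move: M2 hM2; rewrite setTD => M2 hM2; exists M2.
Qed.

Lemma components_partition : partition (components M) [set: T].
Proof.
suff -> : components M = equivalence_partition same_separators [set: T].
  exact: equivalence_partitionP same_separators_equiv.
have e i : component_of i = [set j in [set: T] | same_separators i j].
  by apply/setP => j; rewrite !inE.
apply/setP => S; apply/component_ofP/imsetP => [[i ->]|[i _ ->]]; exists i => //.
Qed.

(** Exchangeable elements share a component, so no exchangeable pair straddles a union of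
    components. *)
Lemma separator_components S : separator M S =
  [forall C in components M, (C \subset S) || [disjoint C & S]].
Proof.
apply/idP/forall_inP => [sS _ /component_ofP[i ->]|h].
  case iS : (i \in S).
    apply/orP; left; apply/subsetP => j; rewrite inE => /same_separatorsP.
    by move/(_ _ sS) <-.
  apply/orP; right; rewrite disjoint_subset; apply/subsetP => j; rewrite inE => /same_separatorsP.
  by move/(_ _ sS); rewrite iS inE => <-.
apply: exchangeable_separator => a b ab.
have bC : b \in component_of a.
  by rewrite inE; apply/same_separatorsP => X sX; apply: separator_exchangeable sX ab.
have /orP[/subsetP sub|dis] := h (component_of a) (introT (component_ofP _) (ex_intro _ a erefl)).
  by rewrite !sub ?mem_component_of.
by rewrite !(disjointFr dis) ?mem_component_of.
Qed.

(** If no exchangeable pair of the component crossed the cut by [S], the part of the component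
    inside [S] would be a separator containing [i] but not [j]. *)
Lemma component_exchangeable i j S : same_separators i j -> i \in S -> j \notin S ->
  exists a b, [/\ exchangeable M a b, same_separators i a, same_separators i b,
    a \in S & b \notin S].
Proof.
move=> ij iS jS; apply: contrapT => none.
suff sep : separator M (component_of i :&: S).
  have /same_separatorsP/(_ _ sep) := ij.
  by rewrite !in_setI mem_component_of iS (negbTE jS) andbF.
have key a b : exchangeable M a b -> a \in component_of i :&: S -> b \in component_of i :&: S.
  move=> ab; have e := separator_exchangeable (component_of_separator i) ab.
  rewrite !in_setI -e => /andP[aC aS]; rewrite aC /=.
  case bS : (b \in S) => //; case: none; exists a, b.
  by move: aC (aC); rewrite {2}e bS !inE.
apply: exchangeable_separator => a b ab; apply/idP/idP; first exact: key.
by apply: key; apply: exchangeable_sym.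
Qed.
End Components.

(** * Minors of totally nonnegative matrices *)

Lemma det_colsub_perm (R : comNzRingType) d m (A : 'M[R]_(d, m)) (f : 'I_d -> 'I_m)
    (s : {perm 'I_d}) :
  \det (colsub (f \o s) A) = (-1) ^+ s * \det (colsub f A).
Proof.
rewrite -det_tr -(det_tr (colsub f A)) -det_perm -det_mulmx -row_permE.
by congr (\det _); apply/matrixP => i j; rewrite !mxE.
Qed.

(** Needed because [maximal_minors_nonneg] speaks only of increasing lists of columns. *)
Lemma sorting_perm d n (f : 'I_d -> 'I_n) : injective f ->
  exists s : {perm 'I_d}, {homo f \o s : i j / (i < j)%N}.
Proof.
move=> finj; pose t : d.-tuple nat := [tuple val (f i) | i < d].
have /tuple_permP[p hp] : perm_eq (sort leq t) t by rewrite perm_sort.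
exists p => i j ij.
have e k : val (f (p k)) = nth 0%N (sort leq t) k.
  by rewrite hp (nth_map k) ?size_enum_ord // tnth_mktuple nth_ord_enum.
rewrite /= !e.
have st : sorted ltn (sort leq t).
  rewrite ltn_sorted_uniq_leq sort_uniq (sort_sorted leq_total) andbT.
  by rewrite map_inj_uniq ?enum_uniq // => x y /val_inj /finj.
by apply: (sorted_ltn_nth ltn_trans) => //; rewrite inE size_sort size_tuple.
Qed.
(** The columns [x] and [y] come first instead of in sorted position, which makes the minor an
    alternating form in them; the sign lost this way is recovered from a Vandermonde determinant. *)
Definition extend_index n k (g : 'I_k -> 'I_n) (x y : 'I_n) (i : 'I_(2 + k)) : 'I_n :=
  match split i with
  | inl i0 => if i0 == 0 then x else y
  | inr j => g j
  end.

Lemma det_mx2 (R : comNzRingType) (A : 'M[R]_2) :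
  \det A = A 0 0 * A 1 1 - A 0 1 * A 1 0.
Proof.
rewrite (expand_det_row _ 0) !big_ord_recl big_ord0 addr0 /cofactor !det_mx11 !mxE /=.
rewrite expr0 expr1 mul1r mulN1r mulrN.
by do ![congr (_ * _) || congr (_ - _)]; congr (A _ _); apply: val_inj.
Qed.

(** Modulo the columns listed by [g] the column space is a plane, so the minor is a multiple of a 2
    by 2 determinant in coordinates of that plane. In this form the three-term relation is a
    polynomial identity. *)
Lemma plucker_vector_form (F : fieldType) n k (A : 'M[F]_(2 + k, n)) (g : 'I_k -> 'I_n) a b :
  \det (colsub (extend_index g a b) A) != 0 ->
  exists (c : F) (u v : 'I_n -> F), forall x y,
    \det (colsub (extend_index g x y) A) = c * (u x * v y - v x * u y).
Proof.
set P := colsub _ A => P0.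
have Pu : P \in unitmx by rewrite unitmxE unitfE.
pose B := invmx P *m A.
have eA : A = P *m B by rewrite mulmxA mulmxV // mul1mx.
have eB : colsub (extend_index g a b) B = 1%:M by rewrite -mulmx_colsub mulVmx.
exists (\det P), (B (lshift k 0)), (B (lshift k 1)) => x y.
rewrite {1}eA -mulmx_colsub det_mulmx; congr (_ * _).
set C := colsub _ B.
(* Multiplying by [invmx P] turned the columns of [g] into the last unit vectors, so [C] is block
   lower triangular with an identity block and only its 2 by 2 corner counts. *)
have Cg i j : C i (rshift 2 j) = (1%:M : 'M_(2 + k)) i (rshift 2 j).
  by rewrite -eB !mxE /extend_index (unsplitK (inr j)).
rewrite -(submxK C).
have -> : ursubmx C = 0.
  by apply/matrixP => i j; rewrite [LHS]mxE [LHS]mxE Cg !mxE eq_lrshift.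
have -> : drsubmx C = 1%:M.
  by apply/matrixP => i j; rewrite [LHS]mxE [LHS]mxE Cg !mxE eq_rshift.
rewrite det_lblock det1 mulr1 det_mx2 /C !mxE /extend_index !(unsplitK (inl _)) /=.
by rewrite [in X in _ - X]mulrC.
Qed.

(** Apart from [h y - h x], the determinant splits into a factor for [x], one for [y] and a common
    [w]. The signs of several minors can then be compared factor by factor. *)
Lemma det_Vandermonde_extend (R : comNzRingType) n k (g : 'I_k -> 'I_n) (h : 'I_n -> R) :
  exists w, forall x y,
  \det (Vandermonde (2 + k) (\row_i h (extend_index g x y i)))
  = (h y - h x) * (\prod_j (h (g j) - h x)) * (\prod_j (h (g j) - h y)) * w.
Proof.
exists (\prod_(i < k) \prod_(j < k | (i < j)%N) (h (g j) - h (g i))) => x y.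
rewrite det_Vandermonde.
have split2 (P : pred 'I_(2 + k)) (F : 'I_(2 + k) -> R) : \prod_(j | P j) F j =
    (if P (lshift k 0) then F (lshift k 0) else 1) *
    (if P (lshift k 1) then F (lshift k 1) else 1) *
    \prod_(j < k | P (rshift 2 j)) F (rshift 2 j).
  rewrite big_split_ord /= big_mkcond !big_ord_recl big_ord0 /= mulr1.
  have -> : lift ord0 ord0 = 1 :> 'I_2 by apply: val_inj.
  by have -> : ord0 = 0 :> 'I_2 by apply: val_inj.
have e0 : extend_index g x y (lshift k 0) = x.
  by rewrite /extend_index (unsplitK (inl _)).
have e1 : extend_index g x y (lshift k 1) = y.
  by rewrite /extend_index (unsplitK (inl _)).
have eg j : extend_index g x y (rshift 2 j) = g j.
  by rewrite /extend_index (unsplitK (inr _)).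
rewrite split2 /= !split2 /= !mul1r !mxE e0 e1 -!mulrA.
congr (_ * _); congr (_ * _); [|congr (_ * _)].
- by apply: eq_bigr => j _; rewrite !mxE eg.
- by apply: eq_bigr => j _; rewrite !mxE eg.
apply: eq_bigr => i _; rewrite split2 /= !mul1r.
by apply: eq_big => [j|j _]; rewrite ?ltn_add2l // !mxE !eg.
Qed.

Lemma det_Vandermonde_neq0 (R : numDomainType) n d (f : 'I_d -> 'I_n) :
  injective f -> \det (Vandermonde d (\row_i (f i : nat)%:R : 'rV[R]_d)) != 0.
Proof.
move=> finj; rewrite det_Vandermonde; apply/prodf_neq0 => i _.
apply/prodf_neq0 => j ij; rewrite !mxE subr_eq0 eqr_nat.
by apply: contraTneq ij => /val_inj/finj ->; rewrite ltnn.
Qed.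

Section TotallyNonnegative.
Variables (R : realType) (n d : nat) (A : 'M[R]_(d, n)).

(** Sorting the columns multiplies both determinants by the same sign, and for increasing columns
    both are nonnegative. *)
Lemma det_colsub_Vandermonde_ge0 (f : 'I_d -> 'I_n) :
  maximal_minors_nonneg A -> injective f ->
  0 <= \det (colsub f A) * \det (Vandermonde d (\row_i (f i : nat)%:R : 'rV[R]_d)).
Proof.
move=> hA finj; have [s hs] := sorting_perm finj.
pose N : 'rV[R]_n := \row_i (i : nat)%:R.
have eN (g : 'I_d -> 'I_n) : Vandermonde d (\row_i (g i : nat)%:R : 'rV[R]_d)
    = colsub g (Vandermonde d N).
  by apply/matrixP => i j; rewrite !mxE.
have e : \det (colsub f A) * \det (colsub f (Vandermonde d N))
    = \det (colsub (f \o s) A) * \det (colsub (f \o s) (Vandermonde d N)).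
  by rewrite !det_colsub_perm mulrACA -expr2 sqrr_sign mul1r.
rewrite eN e mulr_ge0 ?hA // -eN det_Vandermonde.
apply: prodr_ge0 => i _; apply: prodr_ge0 => j ij.
by rewrite !mxE subr_ge0 ler_nat ltnW ?hs.
Qed.

(** The rank depends only on the set of columns, so [f] may list [S] in any order and with
    repetitions. *)
Lemma columns_independent_rank (S : {set 'I_n}) m (f : 'I_m -> 'I_n) :
  [set f i | i : 'I_m] = S -> columns_independent A S = (\rank (colsub f A) == #|S|).
Proof.
move=> fS; rewrite /columns_independent /row_free.
set B := (colsub _ A)^T.
have -> : \rank (colsub f A) = \rank B.
  rewrite -mxrank_tr; apply/eqP; rewrite eqn_leq !mxrankS //.
    apply/row_subP => i; have /imsetP[j _ e] : enum_val i \in [set f i | i : 'I_m].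
      by rewrite fS enum_valP.
    suff -> : row i B = row j (colsub f A)^T by apply: row_sub.
    by apply/rowP => l; rewrite !mxE e.
  apply/row_subP => i; have fi : f i \in S by rewrite -fS imset_f.
  suff -> : row i (colsub f A)^T = row (enum_rank_in fi (f i)) B by apply: row_sub.
  by apply/rowP => l; rewrite !mxE enum_rankK_in.
by [].
Qed.

Lemma columns_independent_card (S : {set 'I_n}) :
  columns_independent A S -> (#|S| <= d)%N.
Proof. by move=> /eqP <-; apply: rank_leq_col. Qed.

(** Full rank provides [d] independent columns; a maximal independent set around them has exactly
    [d] elements, and all bases are equinumerous. *)
Lemma column_bases_card (M : matroid [set: 'I_n]) B :
  \rank A = d -> bases M = column_bases A -> B \in bases M -> #|B| = d.
Proof.
move=> rA eM hB; pose h := maxrankfun A^T; pose S := [set h i | i : 'I_(\rank A^T)].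
have cS : #|S| = d.
  by rewrite card_imset ?card_ord ?mxrank_tr //; apply: maxrankfun_inj.
have iS : columns_independent A S.
  rewrite (columns_independent_rank erefl) cS -mxrank_tr.
  by rewrite trmx_mxsub eq_maxrowsub mxrank_tr rA.
have [B0 mB0 sub] := maxset_exists iS.
have hB0 : B0 \in bases M by rewrite eM inE.
rewrite (bases_card hB hB0); apply/eqP.
rewrite eqn_leq columns_independent_card ?(maxsetp mB0) //.
by rewrite -cS subset_leq_card.
Qed.

Lemma column_bases_det (M : matroid [set: 'I_n]) (f : 'I_d -> 'I_n) :
  \rank A = d -> bases M = column_bases A -> injective f ->
  ([set f i | i : 'I_d] \in bases M) = (\det (colsub f A) != 0).
Proof.
move=> rA eM finj; set B := [set f i | i : 'I_d].
have cB : #|B| = d by rewrite card_imset // card_ord.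
have -> : (B \in bases M) = columns_independent A B.
  apply/idP/idP => [|iB]; first by rewrite eM inE => /maxsetp.
  have [B1 mB1 sub] := maxset_exists iB.
  suff -> : B = B1 by rewrite eM inE.
  apply/eqP; rewrite eqEcard sub cB.
  by rewrite columns_independent_card ?(maxsetp mB1).
by rewrite (columns_independent_rank (f := f)) // cB -unitfE -unitmxE -row_free_unit.
Qed.
End TotallyNonnegative.

Lemma extend_index_inj n k (g : 'I_k -> 'I_n) x y : injective g ->
  x != y -> (forall i, g i != x) -> (forall i, g i != y) ->
  injective (extend_index g x y).
Proof.
move=> ginj xy gx gy i j; rewrite /extend_index -{2}(splitK i) -{2}(splitK j).
have two (i0 : 'I_2) : i0 = 0 \/ i0 = 1.
  by case: i0 => [[|[|//]] lt]; [left|right]; apply: val_inj.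
case: (split i) => i0; case: (split j) => j0 //=; last by move=> /ginj ->.
- case: (two i0) => ->; case: (two j0) => -> //= e; first by rewrite e eqxx in xy.
  by rewrite e eqxx in xy.
- by case: ifP => _ e; [have := gx j0|have := gy j0]; rewrite e eqxx.
- by case: ifP => _ e; [have := gx i0|have := gy i0]; rewrite e eqxx.
Qed.

Lemma extend_index_image n k (g : 'I_k -> 'I_n) x y :
  [set extend_index g x y i | i : 'I_(2 + k)]
  = x |: (y |: [set g i | i : 'I_k]).
Proof.
apply/setP => z; rewrite !inE; apply/imsetP/idP => [[i _ ->]|].
  rewrite /extend_index; case: (split i) => j; last by rewrite imset_f ?orbT.
  by case: ifP; rewrite eqxx ?orbT.
case/or3P => [/eqP ->|/eqP ->|/imsetP[i _ ->]].
- by exists (lshift k 0) => //; rewrite /extend_index (unsplitK (inl _)).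
- by exists (lshift k 1) => //; rewrite /extend_index (unsplitK (inl _)).
- by exists (rshift 2 i) => //; rewrite /extend_index (unsplitK (inr _)).
Qed.

(* Writing [D x y] for the minor on the columns [x, y, I], the three-term
   relation [D p r * D q s = D p q * D r s + D p s * D q r] has nonnegative
   terms once each [D x y] is given the sign of the Vandermonde determinant, so
   its left-hand side cannot vanish. *)
Lemma positroid_crossing (R : realType) n (M : matroid [set: 'I_n])
    (I : {set 'I_n}) (p q r s : 'I_n) :
  positroid R M -> (p < q)%N -> (q < r)%N -> (r < s)%N ->
  [/\ p \notin I, q \notin I, r \notin I & s \notin I] ->
  p |: (q |: I) \in bases M -> r |: (s |: I) \in bases M ->
  p |: (s |: I) \in bases M -> q |: (r |: I) \in bases M ->
  p |: (r |: I) \in bases M.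
Proof.
move=> [d [A [rA hA eM]]] pq qr rs [pI qI rI sI] hpq hrs hps hqr.
have ed : d = (2 + #|I|)%N.
  rewrite -(column_bases_card rA eM hpq) !cardsU1 !inE (negbTE pI) qI.
  by rewrite orbF neq_ltn pq.
subst d; pose g (i : 'I_#|I|) : 'I_n := enum_val i.
have gI : [set g i | i : 'I_#|I|] = I.
  apply/setP => x; apply/imsetP/idP => [[i _ ->]|xI]; first exact: enum_valP.
  by exists (enum_rank_in xI x) => //; rewrite /g enum_rankK_in.
have gN x : x \notin I -> forall i, g i != x.
  by move=> xI i; apply: contraNneq xI => <-; apply: enum_valP.
pose D x y := \det (colsub (extend_index g x y) A).
have finj (x y : 'I_n) : (x < y)%N -> x \notin I -> y \notin I -> injective (extend_index g x y).
  move=> xy xI yI; apply: extend_index_inj; [exact: enum_val_inj| |exact: gN|exact: gN].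
  by apply: contraTneq xy => ->; rewrite ltnn.
have DE (x y : 'I_n) : (x < y)%N -> x \notin I -> y \notin I ->
    (x |: (y |: I) \in bases M) = (D x y != 0).
  by move=> *; rewrite -(column_bases_det rA eM (finj _ _ _ _ _)) // extend_index_image gI.
have [w hw] := det_Vandermonde_extend g (fun i : 'I_n => (i : nat)%:R : R).
pose G (x : 'I_n) : R := \prod_j ((g j : nat)%:R - (x : nat)%:R).
have G0 x : x \notin I -> G x != 0.
  move=> xI; apply/prodf_neq0 => j _; rewrite subr_eq0 eqr_nat.
  exact: gN.
have pos (x y : 'I_n) : (x < y)%N -> x \notin I -> y \notin I -> 0 <= D x y * (G x * G y * w).
  move=> xy xI yI; have := det_colsub_Vandermonde_ge0 hA (finj x y xy xI yI).
  rewrite hw -/(G x) -/(G y) -!mulrA mulrCA pmulr_rge0 // subr_gt0 ltr_nat //.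
have pr := ltn_trans pq qr; have ps := ltn_trans pr rs; have qs := ltn_trans qr rs.
have [nz_pq nz_rs nz_ps nz_qr] : [/\ D p q != 0, D r s != 0, D p s != 0 & D q r != 0].
  by rewrite -!DE.
have w0 : w != 0.
  have := det_Vandermonde_neq0 R (finj p q pq pI qI).
  by rewrite hw; apply: contraNneq => ->; rewrite mulr0.
rewrite DE //; apply/eqP => Dpr.
have [c [u [v huv]]] := plucker_vector_form nz_pq.
have plu : D p r * D q s = D p q * D r s + D p s * D q r.
  by rewrite /D !huv; ring.
have Epq := pos p q pq pI qI; have Ers := pos r s rs rI sI.
have Eps := pos p s ps pI sI; have Eqr := pos q r qr qI rI.
(* Both products on the right of the relation use each of [p], [q], [r], [s] once, so their sign
   corrections multiply to the same [W]. *)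
pose W := G p * G q * G r * G s * w ^+ 2.
have W0 : W != 0 by rewrite !mulf_neq0 ?G0 ?expf_neq0.
have gt0 x y : 0 <= x -> x = y -> y != 0 -> 0 < y :> R.
  by move=> x0 <- xn; rewrite lt_def xn.
have : 0 < W * (D p q * D r s).
  apply: gt0 (mulr_ge0 Epq Ers) _ _; first by rewrite /W; ring.
  by rewrite mulf_neq0 // mulf_neq0.
have : 0 < W * (D p s * D q r).
  apply: gt0 (mulr_ge0 Eps Eqr) _ _; first by rewrite /W; ring.
  by rewrite mulf_neq0 // mulf_neq0.
move=> h1 h2; have := addr_gt0 h2 h1.
by rewrite -mulrDr -plu Dpr mul0r mulr0 ltxx.
Qed.

(** * Components of a positroid do not cross *)

Section ComponentsNoncrossing.
Variables (R : realType) (n : nat) (M : matroid [set: 'I_n]).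
Hypothesis hpos : positroid R M.

(** Suppose [q] is outside [S]. Gluing bases for the two exchanges gives a basis [B] with [p] and
    [q], in which [p] to [r] inside [S] and [q] to [s] outside can be done independently. These four
    bases feed [positroid_crossing], whose conclusion exchanges [q] for [r] across the boundary of
    [S], a contradiction. *)
Lemma exchange_crossing (S : {set 'I_n}) (p q r s : 'I_n) : separator M S ->
  (p < q)%N -> (q < r)%N -> (r < s)%N ->
  exchangeable M p r -> exchangeable M q s -> p \in S -> q \in S.
Proof.
move=> sS pq qr rs epr eqs pS; apply: contraTT isT => qS.
have rS : r \in S by rewrite -(separator_exchangeable sS epr).
have sS' : s \notin S by rewrite -(separator_exchangeable sS eqs).
have [B1 [hB1 pB1 rB1 hB1']] := epr; have [B2 [hB2 qB2 sB2 hB2']] := eqs.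
pose B := (B1 :&: S) :|: (B2 :\: S); pose I := (B :\ p) :\ q.
have hB : B \in bases M by apply: separator_glue.
have pr := ltn_trans pq qr; have ps := ltn_trans pr rs; have qs := ltn_trans qr rs.
have ne (x y : 'I_n) : (x < y)%N -> ((x == y) = false) * ((y == x) = false).
  by move=> xy; rewrite [y == x]eq_sym; split; apply: contraTF xy => /eqP ->; rewrite ltnn.
pose nes := (ne _ _ pq, ne _ _ qr, ne _ _ rs, ne _ _ pr, ne _ _ ps, ne _ _ qs).
pose mems := (pS, negbTE qS, rS, negbTE sS', pB1, negbTE rB1, qB2, negbTE sB2).
have hpr : p |: (r |: I) \in bases M.
  apply: (positroid_crossing hpos pq qr rs).
  - by rewrite !inE !eqxx !nes !mems /= ?andbF ?orbF.
  - suff -> : p |: (q |: I) = B by [].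
    apply/setP => x; rewrite !inE.
    have [->|_] := eqVneq x p; first by rewrite !mems /= ?andbF ?orbT.
    by have [->|_] := eqVneq x q; rewrite ?nes ?mems /= ?andbF.
  - rewrite (_ : _ |: _ = ((r |: (B1 :\ p)) :&: S) :|: ((s |: (B2 :\ q)) :\: S)).
      exact: separator_glue.
    apply/setP => x; rewrite !inE.
    have [->|_] := eqVneq x r; first by rewrite !mems /= ?andbF ?orbT.
    have [->|_] := eqVneq x s; first by rewrite !mems /= ?andbF ?orbT.
    have [->|_] := eqVneq x p; first by rewrite !nes !mems /= ?andbF.
    by have [->|_] := eqVneq x q; rewrite ?nes ?mems /= ?andbF.
  - rewrite (_ : _ |: _ = (B1 :&: S) :|: ((s |: (B2 :\ q)) :\: S)).
      exact: separator_glue.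
    apply/setP => x; rewrite !inE.
    have [->|_] := eqVneq x p; first by rewrite !mems /= ?andbF ?orbT.
    have [->|_] := eqVneq x s; first by rewrite !mems /= ?andbF ?orbT.
    by have [->|_] := eqVneq x q; rewrite ?nes ?mems /= ?andbF.
  - rewrite (_ : _ |: _ = ((r |: (B1 :\ p)) :&: S) :|: (B2 :\: S)).
      exact: separator_glue.
    apply/setP => x; rewrite !inE.
    have [->|_] := eqVneq x q; first by rewrite !mems /= ?andbF ?orbT.
    have [->|_] := eqVneq x r; first by rewrite !mems /= ?andbF ?orbT.
    by have [->|_] := eqVneq x p; rewrite ?nes ?mems /= ?andbF.
suff eqr : exchangeable M q r.
  by move: (separator_exchangeable sS eqr); rewrite !mems.
exists B; split=> //; first by rewrite !inE !mems /= orbT.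
  by rewrite !inE !mems.
suff <- : p |: (r |: I) = r |: (B :\ q) by [].
apply/setP => x; rewrite !inE.
have [->|_] := eqVneq x p; first by rewrite !nes !mems.
by have [->|_] := eqVneq x r.
Qed.

(** Cutting the component of [b] and [d] by the open interval between [x] and [y] yields an
    exchangeable pair [b'], [d'] across it. Either [d'] is an endpoint, and the components agree at
    once, or the two pairs cross and [exchange_crossing] applies. *)
Lemma exchange_component_crossing (x y b d : 'I_n) : exchangeable M x y ->
  (x < b < y)%N -> ~~ (x <= d <= y)%N -> same_separators M b d ->
  same_separators M x b.
Proof.
move=> exy /andP[xb by_] dxy bd.
have [||b' [d' [ebd sb sd]]] := component_exchangeable (S := [set k : 'I_n | x < k < y]%N) bd.
- by rewrite inE xb.
- by rewrite inE; apply: contra dxy => /andP[/ltnW -> /ltnW ->].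
rewrite !inE => /andP[xb' by'] dxy'.
have sxy : same_separators M x y.
  by apply/same_separatorsP => S sS; apply: separator_exchangeable sS exy.
have [dx|xd|dx] := ltngtP (val d') (val x).
- have : x \in component_of M d'.
    apply: (exchange_crossing (component_of_separator M d') dx xb' by' _ exy).
      exact: exchangeable_sym.
    exact: mem_component_of.
  by rewrite inE -(same_separators_trans sd) same_separators_sym.
- have [dy|yd|dy] := ltngtP (val d') (val y).
  + by rewrite xd dy in dxy'.
  + have : b' \in component_of M x.
      apply: (exchange_crossing (component_of_separator M x) xb' by' yd exy ebd).
      exact: mem_component_of.
    by rewrite inE same_separators_sym -(same_separators_trans sb) same_separators_sym.
  + rewrite same_separators_sym (same_separators_trans sd).
    by rewrite (val_inj dy) same_separators_sym.
- rewrite same_separators_sym (same_separators_trans sd).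
  by rewrite (val_inj dx); apply/same_separatorsP.
Qed.

(** The same cut is made once more, now in the component of [p] and [r] by the open interval between
    [q] and [s]. The resulting pair [x], [y] has exactly one of [q], [s] between its members, unless
    [y] is one of them. *)
Lemma components_crossing (p q r s : 'I_n) : (p < q)%N -> (q < r)%N -> (r < s)%N ->
  same_separators M p r -> same_separators M q s -> same_separators M p q.
Proof.
move=> pq qr rs pr qs; apply: contraT => npq.
have rp : same_separators M r p by rewrite same_separators_sym.
have [||x [y [exy rx ry sx sy]]] :=
    component_exchangeable (S := [set k : 'I_n | q < k < s]%N) rp.
- by rewrite inE qr.
- by rewrite inE ltnNge (ltnW pq).
have px : same_separators M p x by rewrite (same_separators_trans pr).
have py : same_separators M p y by rewrite (same_separators_trans pr).
have yq : y != q by apply: contraNneq npq => <-.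
have ys : y != s.
  by apply: contraNneq npq => e; rewrite same_separators_sym (same_separators_trans qs) -e same_separators_sym.
rewrite !inE in sx sy; have /andP[qx xs] := sx.
have [yltq|qley] := ltnP y q.
  have := exchange_component_crossing (exchangeable_sym exy) (b := q) (d := s) _ _ qs.
  rewrite yltq qx negb_and -!ltnNge xs orbT => /(_ isT isT) yq'.
  by rewrite (same_separators_trans py) yq' in npq.
have qlty : (q < y)%N by rewrite ltn_neqAle eq_sym yq qley.
have slty : (s < y)%N.
  by rewrite ltn_neqAle eq_sym ys leqNgt /=; apply: contra sy => ->; rewrite qlty.
have sq : same_separators M s q by rewrite same_separators_sym.
have := exchange_component_crossing exy (b := s) (d := q) _ _ sq.
rewrite xs slty negb_and -!ltnNge qx => /(_ isT isT) xs'.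
by rewrite same_separators_sym (same_separators_trans qs) same_separators_sym (same_separators_trans px) xs' in npq.
Qed.
End ComponentsNoncrossing.

(** Each of the four rotations in [cyclic_order] becomes a linear crossing, after swapping the two
    blocks for the odd rotations. *)
Lemma noncrossing_lt (disp : Order.disp_t) (T : finOrderType disp) (P : {set {set T}}) :
  (forall A B, A \in P -> B \in P -> forall a b c d : T,
     a \in A -> c \in A -> b \in B -> d \in B ->
     (a < b)%O -> (b < c)%O -> (c < d)%O -> A = B) ->
  noncrossing P.
Proof.
move=> h A B hA hB AB a b c d aA cA bB dB.
have k := h A B hA hB; have k' := h B A hB hA.
apply/negP; rewrite /cyclic_order /= !andbT; case/or4P => /and3P[h1 h2 h3].
- by move/eqP: AB; apply; apply: (k a b c d).
- by move/eqP: AB; apply; apply/esym; apply: (k' b c d a).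
- by move/eqP: AB; apply; apply: (k c d a b).
- by move/eqP: AB; apply; apply/esym; apply: (k' d a b c).
Qed.

Lemma components_noncrossing (R : realType) n (M : matroid [set: 'I_n]) :
  positroid R M -> noncrossing (components M).
Proof.
move=> hpos; apply: noncrossing_lt => _ _ /component_ofP[i ->] /component_ofP[j ->].
move=> a b c d; rewrite !inE !ltEord => ia ic jb jd ab bc cd.
have ac : same_separators M a c by rewrite -(same_separators_trans ia).
have bd : same_separators M b d by rewrite -(same_separators_trans jb).
have ab' := components_crossing hpos ab bc cd ac bd.
apply/setP => k; rewrite !inE (same_separators_trans ia) (same_separators_trans ab').
by rewrite (same_separators_trans jb).
Qed.

(** * The dual partition *)

Section DualPartition.
Variables (R : realType) (n : nat) (M : matroid [set: 'I_n]).
Implicit Types i j : 'I_n.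

Lemma prefix_sum_indicator (B : {set 'I_n}) i :
  prefix_sum (indicator R B) i = #|B :&: [set k : 'I_n | (k <= i)%N]|%:R.
Proof.
rewrite /prefix_sum -sum1_card natr_sum [RHS](eq_bigl (fun k : 'I_n => (k <= i)%N && (k \in B))).
  by rewrite big_mkcondr; apply: eq_bigr => k _; rewrite mxE; case: (k \in B).
by move=> k; rewrite !inE andbC.
Qed.

Lemma prefix_sum_comb (w : {set 'I_n} -> R) i :
  prefix_sum (\sum_(B in bases M) w B *: indicator R B) i
  = \sum_(B in bases M) w B * prefix_sum (indicator R B) i.
Proof.
rewrite /prefix_sum (eq_bigr (fun k => \sum_(B in bases M) w B * indicator R B 0 k)).
  by rewrite exchange_big; apply: eq_bigr => B _; rewrite mulr_sumr.
by move=> k _; rewrite summxE; apply: eq_bigr => B _; rewrite mxE.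
Qed.

Lemma matroid_polytope_indicator B : B \in bases M -> matroid_polytope M (indicator R B).
Proof.
move=> hB; exists (fun C => (C == B)%:R); split=> [C||]; first exact: ler0n.
  by rewrite (bigD1 B) //= eqxx big1 ?addr0 // => C /andP[_ /negbTE ->].
rewrite (bigD1 B) //= eqxx scale1r big1 ?addr0 // => C /andP[_ /negbTE ->].
by rewrite scale0r.
Qed.

(** Half-open because [prefix_sum x j - prefix_sum x i] includes coordinate [j] but not [i]. *)
Definition prefix_interval i j : {set 'I_n} := [set k : 'I_n | (i < k <= j)%N].

(** The difference of prefix sums is linear and counts [B :&: prefix_interval i j] at the vertex of
    [B]; it is constant on the polytope as soon as it is constant on the vertices. *)
Lemma dual_equivP i j : (i <= j)%N ->
  dual_equiv R M i j <-> separator M (prefix_interval i j).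
Proof.
move=> ij.
have split (B : {set 'I_n}) : prefix_sum (indicator R B) j - prefix_sum (indicator R B) i
    = #|B :&: prefix_interval i j|%:R.
  rewrite !prefix_sum_indicator.
  rewrite -(cardsID [set k : 'I_n | (k <= i)%N] (B :&: [set k : 'I_n | (k <= j)%N])).
  rewrite natrD addrC (_ : _ :&: _ :&: _ = B :&: [set k : 'I_n | (k <= i)%N]).
    rewrite addKr; congr (#|pred_of_set _|%:R); apply/setP => k; rewrite !inE -ltnNge.
    by rewrite andbCA andbA.
  apply/setP => k; rewrite !inE -andbA; congr andb.
  by apply: andb_idl => ki; apply: leq_trans ij.
split=> [[c hc]|/separatorP sep].
  apply/separatorP => A B hA hB; apply/eqP; rewrite -(eqr_nat R) -!split.
  by rewrite !hc //; apply: matroid_polytope_indicator.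
have /set0Pn[B hB] := bases_nonempty M.
exists #|B :&: prefix_interval i j|%:R => x [w [_ w1 ->]].
(* As the weights sum to 1, the constant [c] is spread over the same convex combination and compared
   termwise. *)
set c := (X in _ = X); rewrite !prefix_sum_comb -sumrB -[c]mul1r -w1 mulr_suml.
by apply: eq_bigr => A hA; rewrite -mulrBr split (sep A B).
Qed.

Lemma dual_equiv_sym i j : dual_equiv R M i j -> dual_equiv R M j i.
Proof. by move=> [c hc]; exists (- c) => x hx; rewrite -(hc x hx) opprB. Qed.

Lemma dual_equiv_trans j i k :
  dual_equiv R M i j -> dual_equiv R M j k -> dual_equiv R M i k.
Proof.
move=> [c hc] [c' hc']; exists (c + c') => x hx.
by rewrite -(hc x hx) -(hc' x hx); ring.
Qed.

Lemma dual_partition_partition : partition (dual_partition R M) [set: 'I_n].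
Proof.
apply: equivalence_partitionP => i j k _ _ _; split.
  by apply/asboolP; exists 0 => x _; rewrite subrr.
move=> /asboolP ij; apply/asboolP/asboolP; apply: dual_equiv_trans => //.
exact: dual_equiv_sym.
Qed.

Lemma dual_partitionP (C : {set 'I_n}) :
  reflect (exists i, C = [set j | `[< dual_equiv R M i j >]]) (C \in dual_partition R M).
Proof.
have e i : [set j in [set: 'I_n] | `[< dual_equiv R M i j >]] = [set j | `[< dual_equiv R M i j >]].
  by apply/setP => j; rewrite !inE.
apply: (iffP imsetP) => [[i _ ->]|[i ->]]; exists i => //.
Qed.

Lemma dual_partition_equiv (C : {set 'I_n}) i j :
  C \in dual_partition R M -> i \in C -> j \in C -> dual_equiv R M i j.
Proof.
move=> /dual_partitionP[k ->]; rewrite !inE => /asboolP ki /asboolP.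
exact/dual_equiv_trans/dual_equiv_sym.
Qed.

Lemma dual_partition_eq (C D : {set 'I_n}) i j :
  C \in dual_partition R M -> D \in dual_partition R M ->
  i \in C -> j \in D -> dual_equiv R M i j -> C = D.
Proof.
move=> /dual_partitionP[k ->] /dual_partitionP[l ->].
rewrite !inE => /asboolP ki /asboolP lj ij; have kl := dual_equiv_trans (dual_equiv_trans ki ij) (dual_equiv_sym lj).
apply/setP => m; rewrite !inE; apply/asboolP/asboolP; apply: dual_equiv_trans => //.
exact: dual_equiv_sym.
Qed.

(** For a crossing a < b < c < d, the interval (b, c] is the intersection of the separators (a, c]
    and (b, d], so [b] and [c] are already equivalent. *)
Lemma dual_partition_noncrossing : noncrossing (dual_partition R M).
Proof.
apply: noncrossing_lt => C D hC hD a b c d aC cC bD dD.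
rewrite !ltEord => ab bc cd.
have /dual_equivP sac := dual_partition_equiv hC aC cC.
have /dual_equivP sbd := dual_partition_equiv hD bD dD.
apply/esym; apply: (dual_partition_eq hD hC bD cC).
apply/(dual_equivP (ltnW bc)).
have -> : prefix_interval b c = prefix_interval a c :&: prefix_interval b d.
  apply/setP => k; rewrite !inE; lia.
by apply: separatorI; [apply: sac|apply: sbd]; lia.
Qed.

(** * The interleaved partition and its coarsest completion *)

Lemma mem_node b b' i (B : {set 'I_n}) :
  (node b i \in [set node b' k | k in B]) = (b == b') && (i \in B).
Proof.
apply/imsetP/andP => [[k kB [-> ->]]|[/eqP -> iB]]; first by [].
by exists i.
Qed.

Lemma node_lt b b' i j :
  (node b i < node b' j)%O = (i < j)%N || (i == j) && (~~ b && b').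
Proof.
rewrite ltEprodlexi /= !leEord -val_eqE /=.
by case: b; case: b'; case: ltngtP.
Qed.

Lemma interleaveP (P K : {set {set 'I_n}}) X :
  reflect (exists b B, B \in (if b then K else P) /\ X = [set node b i | i in B])
    (X \in interleave P K).
Proof.
apply: (iffP setUP) => [[/imsetP[B hB ->]|/imsetP[B hB ->]]|[[] [B [hB ->]]]].
- by exists false, B.
- by exists true, B.
- by right; apply: imset_f.
- by left; apply: imset_f.
Qed.

Lemma interleave_partition (P K : {set {set 'I_n}}) :
  partition P [set: 'I_n] -> partition K [set: 'I_n] ->
  partition (interleave P K) [set: 'I_n *l bool].
Proof.
move=> pP pK.
have pt (b : bool) : partition (if b then K else P) [set: 'I_n] by case: b.
apply/and3P; split.
- apply/eqP/setP => -[i b]; rewrite inE; have /and3P[/eqP cov _ _] := pt b.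
  have : i \in cover (if b then K else P) by rewrite cov.
  move=> /bigcupP[B hB iB]; apply/bigcupP; exists [set node b i | i in B].
    by apply/interleaveP; exists b, B.
  by rewrite -/(node b i) mem_node eqxx.
- apply/trivIsetP => _ _ /interleaveP[b [B [hB ->]]] /interleaveP[c [C [hC ->]]].
  apply: contraR => /pred0Pn[[i e]] /=; rewrite -/(node e i) !mem_node.
  case/andP => /andP[/eqP eb iB] /andP[/eqP ec iC].
  move: hB hC; rewrite -eb -ec => hB hC; have /and3P[_ tr _] := pt e.
  by rewrite -(def_pblock tr hB iB) (def_pblock tr hC iC).
- apply/interleaveP => -[b [B [hB e]]]; have /and3P[_ _] := pt b.
  suff -> : set0 = B by rewrite hB.
  apply/setP => i; have /setP/(_ (node b i)) := e.
  by rewrite mem_node eqxx !inE.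
Qed.

Lemma separator_component_closed (C : {set 'I_n}) (S : {set 'I_n}) i j :
  separator M S -> C \in components M -> i \in C -> j \in C -> i \in S -> j \in S.
Proof.
rewrite separator_components => /forall_inP h /h /orP[/subsetP sub _ /sub //|dis] iC.
by rewrite (disjointFr dis iC).
Qed.

(** Blocks of the same kind do not cross by the two separate results. For blocks of different kinds,
    the unprimed nodes between i' and j' are exactly those in (i, j]; this is a separator, so no
    component has points both inside and outside it. *)
Lemma interleave_noncrossing :
  noncrossing (components M) ->
  noncrossing (interleave (components M) (dual_partition R M)).
Proof.
move=> nc; apply: noncrossing_lt => _ _ /interleaveP[b [B [hB ->]]] /interleaveP[c [C [hC ->]]].
move=> [i1 b1] [i2 b2] [i3 b3] [i4 b4].
rewrite -!/(node _ _) !mem_node => /andP[/eqP -> h1] /andP[/eqP -> h3] /andP[/eqP -> h2] /andP[/eqP -> h4].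
rewrite !node_lt; case: b hB => hB; case: c hC => hC; rewrite /= ?andbF ?orbF ?andbT.
- move=> l12 l23 l34; suff -> : B = C by [].
  apply/eqP; apply: contraT => BC.
  have := dual_partition_noncrossing hB hC BC h1 h3 h2 h4.
  by rewrite /cyclic_order /= !ltEord l12 l23 l34.
- rewrite -!val_eqE /= => l12 l23 l34.
  have i13 : (i1 <= i3)%N by lia.
  have /(dual_equivP i13) sep := dual_partition_equiv hB h1 h3.
  by have := separator_component_closed sep hC h2 h4; rewrite !inE; lia.
- rewrite -!val_eqE /= => l12 l23 l34.
  have i24 : (i2 <= i4)%N by lia.
  have /(dual_equivP i24) sep := dual_partition_equiv hC h2 h4.
  by have := separator_component_closed sep hB h3 h1; rewrite !inE; lia.
- move=> l12 l23 l34; suff -> : B = C by [].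
  apply/eqP; apply: contraT => BC.
  have := nc _ _ hB hC BC _ _ _ _ h1 h3 h2 h4.
  by rewrite /cyclic_order /= !ltEord l12 l23 l34.
Qed.

(** If i' and j' share a block of [Q] but (i, j] is not a separator, some component has a point [k]
    inside and a point [l] outside the interval, and it crosses that block. *)
Lemma dual_partition_coarsest (Q : {set {set 'I_n}}) :
  partition Q [set: 'I_n] -> noncrossing (interleave (components M) Q) ->
  coarser (dual_partition R M) Q.
Proof.
move=> pQ nc B hB.
have key i j : i \in B -> j \in B -> (i <= j)%N -> dual_equiv R M i j.
  move=> iB jB ij; apply/(dual_equivP ij); rewrite separator_components.
  apply/forall_inP => C hC; apply: contraT; rewrite negb_or.
  case/andP => /subsetPn[l lC lS] /pred0Pn[k /andP[/= kC kS]].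
  have hC' : [set node false i | i in C] \in interleave (components M) Q.
    by apply/interleaveP; exists false, C.
  have hB' : [set node true i | i in B] \in interleave (components M) Q.
    by apply/interleaveP; exists true, B.
  have neq : [set node false i | i in C] != [set node true i | i in B].
    by apply/eqP => /setP/(_ (node false k)); rewrite !mem_node kC.
  (* The cyclic order k, j', l, i' covers both positions of [l], before i' or after j'. *)
  have := nc _ _ hC' hB' neq (node false k) (node true j) (node false l) (node true i).
  rewrite !mem_node eqxx => /(_ kC lC jB iB).
  rewrite /cyclic_order /= !node_lt -!val_eqE /=.
  move: kS lS; rewrite !inE => kS lS; lia.
have /and3P[/eqP cov _ _] := dual_partition_partition.
have /and3P[_ _ nz] := pQ.
have /set0Pn[i iB] : B != set0 by apply: contraNneq nz => <-.
have : i \in cover (dual_partition R M) by rewrite cov.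
case/bigcupP => C hC iC; exists C => //; apply/subsetP => j jB.
have ij : dual_equiv R M i j.
  by have [ij|/ltnW ji] := leqP i j; [|apply: dual_equiv_sym]; apply: key.
have : j \in cover (dual_partition R M) by rewrite cov.
by case/bigcupP => D hD jD; rewrite (dual_partition_eq hC hD iC jD ij).
Qed.
End DualPartition.

Theorem theorem8p2 (R : realType) (n d : nat) (M : matroid [set: 'I_n])
    (hpos : positroid R M) (hrank : rank_of M = d) :
  [/\ noncrossing_partition (components M),
      is_kreweras_complement (components M) (dual_partition R M)
    & noncrossing_partition (dual_partition R M)].
Proof.
have ncP := components_noncrossing hpos.
have pK := dual_partition_partition R M.
split; [by split; [exact: components_partition|]| |by split; [|exact: dual_partition_noncrossing]].
split=> //; last by move=> Q pQ [_]; apply: dual_partition_coarsest.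
split; last exact: interleave_noncrossing.
exact: interleave_partition (components_partition M) pK.
Qed.
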